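(* Let $G=(V,E,\mathsf{wt})$ be a weighted graph with $n$ nodes and $m$ edges, let $u\in V$ and $c\in\mathbb{Z}_{\le 0}$. The decision problem of whether $\mathsf{E}(u)\ge c$ can be solved in $O(n\cdot m)$ time and $O(n)$ space.
   Context: A weighted graph $G=(V,E,\mathsf{wt})$ has finite node set $V$, edge set $E\subseteq V\times V$ and weight function $\mathsf{wt}:E\to\mathbb{Z}$; every node has at least one outgoing edge. The weight of a finite path is the sum of its edge weights (the single-node path has weight $0$). For $u\in V$, the (non-positive) minimum initial credit $\mathsf{E}(u)\in\mathbb{Z}_{\le 0}\cup\{-\infty\}$ is the largest value such that there exists an infinite path $(u_1,u_2,\dots)$ with $u_1=u$ for which every finite prefix $P$ satisfies $\mathsf{E}(u)+\mathsf{wt}(P)\le 0$; $\mathsf{E}(u)=-\infty$ if no finite such value exists. (The standard minimum initial credit problem, where one keeps partial sums nonnegative, is obtained by negating all weights.) Time is measured in arithmetic and logical operations, space in machine words. *)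

(* Defs.v *)
From HB Require Import structures.
From mathcomp Require Import all_boot all_order all_algebra.
From mathcomp Require Import boolp constructive_ereal.

Set Implicit Arguments.
Unset Strict Implicit.
Unset Printing Implicit Defensive.
Import Order.TTheory GRing.Theory Num.Theory.
Local Open Scope ring_scope.

(* Only the values of [wt] on [edges] are ever used. *)
Record wgraph := WGraph {
  node :> finType;
  edges : {set node * node};
  wt : node * node -> int;
  out_edge : forall x : node, exists y : node, (x, y) \in edges
}.

Definition infinite_path (G : wgraph) (u : G) (p : nat -> G) : Prop :=
  p 0%N = u /\ forall i, (p i, p i.+1) \in edges G.

(* Weight of the prefix of [p] with [k] edges. *)
Definition prefix_weight (G : wgraph) (p : nat -> G) (k : nat) : int :=
  \sum_(i < k) wt (p i, p i.+1).

(* The prefix without edges (k = 0) forces e <= 0. *)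
Definition sufficient_credit (G : wgraph) (u : G) (e : int) : Prop :=
  exists p : nat -> G,
    infinite_path u p /\ forall k, e + prefix_weight p k <= 0.

Definition largest_credit (G : wgraph) (u : G) (e : int) : Prop :=
  sufficient_credit u e /\ forall e', sufficient_credit u e' -> e' <= e.

Definition min_credit (G : wgraph) (u : G) : \bar int :=
  match pselect (exists e, largest_credit u e) with
  | left ex_e => (projT1 (cid ex_e))%:E
  | right _ => -oo%E
  end.

(* A random-access machine with unit-cost operations. It has a read-only input
   and a work memory of a fixed number of cells, both with random access; the
   program variables also live in the work memory. A run is stuck, that is, it
   has no derivation, if it uses an address outside of the input or memory, or
   if it produces a value that does not fit in a machine word, that is, whose
   absolute value is larger than [B]. *)

Inductive binop := OpAdd | OpSub | OpMul | OpLeq | OpEq | OpAnd | OpOr.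

Inductive expr :=
| Const of int
| Read of expr
| Input of expr
| Bin of binop & expr & expr.

Inductive cmd :=
| Skip
| Store of expr & expr (* address, value *)
| Seq of cmd & cmd
| If of expr & cmd & cmd
| While of expr & cmd.

Definition of_bool (b : bool) : int := (b : nat)%:Z.

Definition binop_val (o : binop) (x y : int) : int :=
  match o with
  | OpAdd => x + y
  | OpSub => x - y
  | OpMul => x * y
  | OpLeq => of_bool (x <= y)
  | OpEq => of_bool (x == y)
  | OpAnd => of_bool ((x != 0) && (y != 0))
  | OpOr => of_bool ((x != 0) || (y != 0))
  end.

Definition word (B : nat) (x : int) : option int :=
  if (absz x <= B)%N then Some x else None.

Definition fetch (s : seq int) (a : int) : option int :=
  match a with
  | Posz k => if (k < size s)%N then Some (nth 0 s k) else None
  | Negz _ => None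
  end.

Fixpoint eval (B : nat) (inp mem : seq int) (e : expr) : option int :=
  match e with
  | Const x => word B x
  | Read e1 => obind (fun a => obind (word B) (fetch mem a)) (eval B inp mem e1)
  | Input e1 => obind (fun a => obind (word B) (fetch inp a)) (eval B inp mem e1)
  | Bin o e1 e2 =>
      obind (fun x => obind (fun y => word B (binop_val o x y))
                            (eval B inp mem e2))
            (eval B inp mem e1)
  end.

(* One time unit for each constant, memory access, input access and
   operation. *)
Fixpoint esize (e : expr) : nat :=
  match e with
  | Const _ => 1
  | Read e1 | Input e1 => (esize e1).+1
  | Bin _ e1 e2 => (esize e1 + esize e2).+1
  end.

Fixpoint csize (c : cmd) : nat :=
  match c with
  | Skip => 1
  | Store e1 e2 => (esize e1 + esize e2).+1
  | Seq c1 c2 => (csize c1 + csize c2).+1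
  | If e c1 c2 => (esize e + csize c1 + csize c2).+1
  | While e c1 => (esize e + csize c1).+1
  end.

(* [exec B inp c mem t mem']: started in [mem], the command [c] halts in [mem']
   after [t] time units. *)
Inductive exec (B : nat) (inp : seq int) :
    cmd -> seq int -> nat -> seq int -> Prop :=
| ExecSkip mem :
    exec B inp Skip mem 1 mem
| ExecStore mem e1 e2 (k : nat) x :
    eval B inp mem e1 = Some (Posz k) -> (k < size mem)%N ->
    eval B inp mem e2 = Some x ->
    exec B inp (Store e1 e2) mem (esize e1 + esize e2).+1 (set_nth 0 mem k x)
| ExecSeq c1 c2 mem t1 mem1 t2 mem2 :
    exec B inp c1 mem t1 mem1 -> exec B inp c2 mem1 t2 mem2 ->
    exec B inp (Seq c1 c2) mem (t1 + t2) mem2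
| ExecIf e c1 c2 mem x t mem' :
    eval B inp mem e = Some x ->
    exec B inp (if x != 0 then c1 else c2) mem t mem' ->
    exec B inp (If e c1 c2) mem (esize e + t).+1 mem'
| ExecWhileEnd e c mem :
    eval B inp mem e = Some 0 ->
    exec B inp (While e c) mem (esize e).+1 mem
| ExecWhileStep e c mem x t1 mem1 t2 mem2 :
    eval B inp mem e = Some x -> x != 0 ->
    exec B inp c mem t1 mem1 -> exec B inp (While e c) mem1 t2 mem2 ->
    exec B inp (While e c) mem (esize e + t1 + t2).+1 mem2.

(* From a zeroed work memory, [p] halts on [inp] within time [T] and space [S],
   with the answer [b] in cell 0, using words of absolute value at most [B].
   Besides the cells of the work memory, the space includes one word for each
   node of the syntax tree of [p], which pays for the temporaries used in the
   evaluation of expressions. *)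
Definition answers_within (p : cmd) (inp : seq int) (B T S : nat) (b : bool) :
    Prop :=
  exists (cells t : nat) (mem : seq int),
    [/\ exec B inp p (nseq cells 0) t mem,
        (t <= T)%N,
        (cells + csize p <= S)%N
      & nth 0 mem 0 = of_bool b].

(* Nodes are numbered by an arbitrary enumeration [vs], and the edges are given,
   in the arbitrary order [es], as triples source, target, weight. *)
Definition encode (G : wgraph) (vs : seq G) (es : seq (G * G)) (u : G)
    (c : int) : seq int :=
  [:: Posz #|G|; Posz #|edges G|; Posz (index u vs); c]
  ++ flatten [seq [:: Posz (index e.1 vs); Posz (index e.2 vs); wt e] | e <- es].

Definition is_input (G : wgraph) (u : G) (c : int) (inp : seq int) : Prop :=
  exists (vs : seq G) (es : seq (G * G)),
    [/\ perm_eq vs (enum G), perm_eq es (enum (edges G))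
      & inp = encode vs es u c].

Definition max_weight (G : wgraph) : nat :=
  (\max_(e in edges G) absz (wt e))%N.

(* Words of K * log2 (magnitude G c) bits. *)
Definition magnitude (G : wgraph) (c : int) : nat :=
  (2 + #|G| + #|edges G| + max_weight G + absz c)%N.

(* Main.v *)
Require Import Defs.
From mathcomp Require Import all_boot all_order all_algebra.
From mathcomp Require Import boolp constructive_ereal.
From mathcomp Require Import zify.

Set Implicit Arguments.
Unset Strict Implicit.
Unset Printing Implicit Defensive.
Import Order.TTheory GRing.Theory Num.Theory.
Local Open Scope ring_scope.

(* [E(u) >= c] holds iff some infinite path from [u] keeps [c] plus its prefix
   weights nonpositive. Replace the weights [w] by [(n+1) w - 1] and the initial
   value [c] by [(n+1) c - 1], and ask for negative prefix sums. On paths with at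
   most [n] edges this is the original condition, and a cycle without repeated
   nodes has nonpositive weight iff its perturbed weight is negative. Run [n] rounds
   of in-place Bellman-Ford from [u] that keep only negative values, with [0]
   standing for an unreached node; the answer is whether the last round changes a
   value. If it does, the new value belongs to a walk that cannot be shortened to
   fewer than [n] edges, so the walk contains a negative cycle, which gives an
   admissible lasso. If it does not, the values form a fixed point, which bounds
   from below the perturbed costs along an admissible infinite path, and these tend
   to minus infinity. *)

(** * The credit threshold as existence of an infinite path *)

Section Credit.
Variables (G : wgraph) (u : G) (c : int).

Lemma sufficient_credit_le (e e' : int) :
  e' <= e -> sufficient_credit u e -> sufficient_credit u e'.
Proof.
move=> le_e [p [pP pe]]; exists p; split=> // k.
by apply: le_trans (pe k); rewrite lerD2r.
Qed.

Lemma sufficient_credit_le0 (e : int) : sufficient_credit u e -> e <= 0.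
Proof. by case=> p [_ /(_ 0%N)]; rewrite /prefix_weight big_ord0 addr0. Qed.

(** Sufficient credits are integers bounded above by 0, so the maximum is [- k] for the least
    natural [k] with [- k] sufficient. *)
Lemma largest_credit_exists : sufficient_credit u c ->
  exists2 e, c <= e & largest_credit u e.
Proof.
move=> sc; have c_le0 := sufficient_credit_le0 sc.
pose P k := `[< sufficient_credit u (- k%:Z) >].
have exP : exists k, P k.
  by exists `|c|%N; apply/asboolP; rewrite (_ : - _ = c) //; lia.
case: (ex_minnP exP) => k /asboolP Pk k_min.
have e_le (e : int) : sufficient_credit u e -> e <= - k%:Z.
  move=> se; have e_le0 := sufficient_credit_le0 se.
  have /k_min : P `|e|%N.
    by apply/asboolP; rewrite (_ : - _ = e) //; lia.
  by lia.
by exists (- k%:Z); [apply: e_le | split].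
Qed.

Lemma le_min_credit : (c%:E <= min_credit u)%E <-> sufficient_credit u c.
Proof.
rewrite /min_credit; case: pselect => [ex_e | nex].
  case: cid => e /= [se e_max]; rewrite lee_fin; split=> [ce | /e_max //].
  exact: sufficient_credit_le ce se.
split=> [|/largest_credit_exists [e _ le]]; first by rewrite leeNy_eq.
by case: nex; exists e.
Qed.

(** * Perturbed weights, walks and lassos *)

Definition scaled_wt (e : G * G) : int := #|G|.+1%:Z * wt e - 1.

(** Closed form of the initial value [(n+1) c - 1] plus [k] perturbed edge weights; each edge
    accounts for one unit of [k]. *)
Definition scaled_cost (q : nat -> G) (k : nat) : int :=
  #|G|.+1%:Z * (c + prefix_weight q k) - 1 - k%:Z.

Lemma prefix_weightS (q : nat -> G) k :
  prefix_weight q k.+1 = prefix_weight q k + wt (q k, q k.+1).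
Proof. by rewrite /prefix_weight big_ord_recr. Qed.

Lemma scaled_costS q k :
  scaled_cost q k.+1 = scaled_cost q k + scaled_wt (q k, q k.+1).
Proof. by rewrite /scaled_cost /scaled_wt prefix_weightS; lia. Qed.

Lemma scaled_cost0 q : scaled_cost q 0 = #|G|.+1%:Z * c - 1.
Proof. by rewrite /scaled_cost /prefix_weight big_ord0; lia. Qed.

(** A finite walk is stored as a total function whose values beyond index [L] are arbitrary. *)
Definition walk (q : nat -> G) (L : nat) : Prop :=
  [/\ q 0%N = u, forall k, (k < L)%N -> (q k, q k.+1) \in edges G
    & forall k, (k <= L)%N -> scaled_cost q k < 0].

Lemma eq_scaled_cost q q' k : (forall i, (i <= k)%N -> q i = q' i) ->
  scaled_cost q k = scaled_cost q' k.
Proof.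
elim: k => [|k IHk] eq_q; first by rewrite !scaled_cost0.
rewrite !scaled_costS (eq_q k) // (eq_q k.+1) // IHk // => i le_ik.
by apply: eq_q; apply: leqW.
Qed.

Lemma walk_rcons q L v : walk q L -> (q L, v) \in edges G ->
    scaled_cost q L + scaled_wt (q L, v) < 0 ->
  exists q', [/\ walk q' L.+1, q' L.+1 = v
    & scaled_cost q' L.+1 = scaled_cost q L + scaled_wt (q L, v)].
Proof.
move=> [q0 qE q_lt0] e_in cost_lt0.
pose q' k := if (k <= L)%N then q k else v.
have q'E k : (k <= L)%N -> q' k = q k by rewrite /q' => ->.
have q'L : q' L.+1 = v by rewrite /q' ltnn.
have costE k : (k <= L)%N -> scaled_cost q' k = scaled_cost q k.
  move=> leL; apply: eq_scaled_cost => i le_ik; apply: q'E.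
  exact: leq_trans leL.
have costL : scaled_cost q' L.+1 = scaled_cost q L + scaled_wt (q L, v).
  by rewrite scaled_costS costE // q'L q'E.
exists q'; split=> //; split; first by rewrite q'E.
- move=> k; rewrite ltnS leq_eqVlt => /predU1P [->|lt_kL].
    by rewrite q'L q'E.
  by rewrite !q'E // 1?ltnW //; apply: qE.
- move=> k; rewrite leq_eqVlt => /predU1P [->|]; first by rewrite costL.
  by rewrite ltnS => leL; rewrite costE //; apply: q_lt0.
Qed.

(** The cost is [(n+1) x - (k+1)] with [k+1 <= n+1]; being negative, it forces [x < 1], and [x] is
    an integer. *)
Lemma scaled_cost_lt0 q k : (k <= #|G|)%N ->
  scaled_cost q k < 0 -> c + prefix_weight q k <= 0.
Proof. by rewrite /scaled_cost => le_k cost_lt0; nia. Qed.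

(** The infinite path follows [q] to [j] and then repeats the cycle from [i] to [j] forever. Since
    the cycle does not increase the weight, every prefix weighs at most as much as the prefix of [q]
    ending at the same position. *)
Lemma lasso_credit q i j : q 0%N = u -> (i < j)%N -> q i = q j ->
    (forall k, (k < j)%N -> (q k, q k.+1) \in edges G) ->
    (forall k, (k < j)%N -> c + prefix_weight q k <= 0) ->
    prefix_weight q j <= prefix_weight q i ->
  sufficient_credit u c.
Proof.
move=> q0 lt_ij eq_q qE q_le0 cyc.
(* Positions on the lasso: position [j], which carries the same node as [i], is replaced by [i]. *)
pose next k := if (k.+1 < j)%N then k.+1 else i.
pose r m := iter m next 0%N.
have r_lt m : (r m < j)%N.
  elim: m => [|m IHm]; first exact: leq_ltn_trans lt_ij.
  by rewrite /r iterS /next; case: ifP.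
have q_next k : (k < j)%N -> q (next k) = q k.+1.
  move=> lt_k; rewrite /next; case: (ltnP k.+1 j) => // le_j.
  by rewrite eq_q; congr q; apply/eqP; rewrite eqn_leq le_j.
have w_next k : (k < j)%N -> prefix_weight q k.+1 <= prefix_weight q (next k).
  move=> lt_k; rewrite /next; case: (ltnP k.+1 j) => // le_j.
  by rewrite (_ : k.+1 = j) //; apply/eqP; rewrite eqn_leq le_j lt_k.
exists (q \o r); split; first split => // m /=.
  by rewrite q_next //; apply: qE.
suff le_r m : prefix_weight (q \o r) m <= prefix_weight q (r m).
  by move=> m; apply: le_trans (q_le0 _ (r_lt m)); rewrite lerD2l.
elim: m => [|m IHm]; first by rewrite /prefix_weight !big_ord0.
apply: le_trans (w_next _ (r_lt m)); rewrite !prefix_weightS /=.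
by rewrite q_next // lerD2r.
Qed.

(** Here [q'] is [q] with the cycle between [i] and [j] cut out, so each later cost loses the
    perturbed weight of that cycle. *)
Lemma scaled_cost_shift q q' i j k : q i = q j ->
    (forall l, (l <= i)%N -> q' l = q l) ->
    (forall l, (i < l)%N -> q' l = q (l + (j - i))%N) ->
    (i <= j)%N -> (i <= k)%N ->
  scaled_cost q' k = scaled_cost q (k + (j - i)) - (scaled_cost q j - scaled_cost q i).
Proof.
move=> eq_q q'l q'r le_ij /subnK <-.
elim: (k - i)%N => [|m IHm].
  by rewrite add0n subnKC // (eq_scaled_cost q'l); lia.
rewrite !addSn !scaled_costS IHm (q'r (m + i).+1) ?ltnS ?leq_addl // addSn.
suff -> : q' (m + i)%N = q (m + i + (j - i))%N by lia.
case: m {IHm} => [|m]; last by rewrite q'r // addSn ltnS leq_addl.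
by rewrite add0n q'l // subnKC.
Qed.

(** Among the first [n+1] nodes of a long walk two coincide. If the cycle between them has negative
    perturbed weight, it closes a lasso. Otherwise cutting it out raises no cost, so the result is a
    shorter walk, and induction on the length applies. *)
Lemma walk_shorten q L : walk q L ->
  sufficient_credit u c \/
  exists q' L', [/\ walk q' L', (L' < #|G|)%N, q' L' = q L
                  & scaled_cost q' L' <= scaled_cost q L].
Proof.
elim/ltn_ind: L q => L IHL q qW; have [q0 qE q_lt0] := qW.
have [lt_L|le_L] := ltnP L #|G|; first by right; exists q, L.
have [i [j [lt_ij le_j eq_q]]] :
    exists i j, [/\ (i < j)%N, (j <= #|G|)%N & q i = q j].
  have /injectiveP : ~~ injectiveb (fun k : 'I_#|G|.+1 => q k).
    by apply/negP => /injectiveP /leq_card; rewrite card_ord ltnn.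
  move=> ninj; apply: contrapT => nex; apply: ninj => a b eq_ab.
  apply/val_inj; have [lt|lt|//] := ltngtP (a : nat) b; case: nex.
    by exists a, b; split=> //; rewrite -ltnS.
  by exists b, a; split=> //; rewrite -ltnS.
have [cyc_lt0|cyc_ge0] := ltP (scaled_cost q j) (scaled_cost q i).
  left; apply: (lasso_credit q0 lt_ij eq_q).
  - by move=> k lt_k; apply: qE; lia.
  - by move=> k lt_k; apply: scaled_cost_lt0; [lia | apply: q_lt0; lia].
  (* For a cycle of weight [w], [(n+1) w < j - i <= n] forces [w <= 0]. *)
  - by move: cyc_lt0; rewrite /scaled_cost; nia.
pose q' k := if (k <= i)%N then q k else q (k + (j - i))%N.
have q'l l : (l <= i)%N -> q' l = q l by rewrite /q' => ->.
have q'r l : (i < l)%N -> q' l = q (l + (j - i))%N.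
  by rewrite ltnNge /q' => /negbTE ->.
have le_ij := ltnW lt_ij.
(* Both branches of [q'] agree at [i] because [q i = q j]. *)
have q'i l : (i <= l)%N -> q' l = q (l + (j - i))%N.
  rewrite leq_eqVlt => /predU1P [<-|/q'r //].
  by rewrite q'l // subnKC.
have cost_r k := scaled_cost_shift eq_q q'l q'r le_ij (k := k).
pose L' := (L - (j - i))%N.
have L'E : (L' + (j - i) = L)%N by rewrite /L'; lia.
have q'W : walk q' L'.
  split; first by rewrite q'l.
  - move=> k lt_k; have [lt_ki|le_ik] := ltnP k i.
      by rewrite !q'l //; [apply: qE; lia | lia].
    by rewrite !q'i // ?addSn; [apply: qE; lia | lia].
  - move=> k le_k; have [le_ki|lt_ik] := leqP k i.
      rewrite (@eq_scaled_cost _ q); first by apply: q_lt0; lia.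
      by move=> l le_l; apply: q'l; lia.
    rewrite cost_r; last lia.
    by have := q_lt0 (k + (j - i))%N; lia.
have ltL' : (L' < L)%N by rewrite /L'; lia.
have [sc|[q2 [L2 [q2W lt_L2 q2L cost2]]]] := IHL L' ltL' q' q'W; first by left.
right; exists q2, L2; split=> //; first by rewrite q2L q'i ?L'E // /L'; lia.
by apply: le_trans cost2 _; rewrite cost_r ?L'E; [lia | rewrite /L'; lia].
Qed.

(** * In-place relaxation restricted to negative values *)

Definition state : Type := (G -> int) * bool.

Definition dist0 (v : G) : int := if v == u then #|G|.+1%:Z * c - 1 else 0.

(** Over the integers these are the strict conditions [d e.1 < 0] and [d e.1 + scaled_wt e < d e.2],
    phrased with [<=] to match the comparison of the machine. *)
Definition relaxable (d : G -> int) (e : G * G) : bool :=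
  (d e.1 <= -1) && (d e.1 + scaled_wt e + 1 <= d e.2).

Definition relax (st : state) (e : G * G) : state :=
  if relaxable st.1 e
  then (fun v => if v == e.2 then st.1 e.1 + scaled_wt e else st.1 v, true)
  else st.

Definition relax_round (es : seq (G * G)) (st : state) : state :=
  foldl relax (st.1, false) es.

Definition bellman_ford es k : state := iter k (relax_round es) (dist0, false).

Lemma relax_le (st : state) e v : (relax st e).1 v <= st.1 v.
Proof.
rewrite /relax; case: ifP => //= /andP [_ le_e].
by case: eqP => // ->; lia.
Qed.

Lemma relax_edge (st : state) e : st.1 e.1 < 0 ->
  (relax st e).1 e.2 <= st.1 e.1 + scaled_wt e.
Proof.
rewrite /relax /relaxable => lt0; case: ifP => [_ | /negbT].
  by rewrite /= eqxx.
by rewrite negb_and; lia.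
Qed.

Lemma foldl_relax_le es (st : state) v : (foldl relax st es).1 v <= st.1 v.
Proof.
elim: es st => //= e es IHes st.
exact: le_trans (IHes _) (relax_le st e v).
Qed.

(** Values never increase: the source is still negative and no larger when [e] is scanned, and the
    target can only drop afterwards. *)
Lemma foldl_relax_edge es (st : state) e : e \in es -> st.1 e.1 < 0 ->
  (foldl relax st es).1 e.2 <= st.1 e.1 + scaled_wt e.
Proof.
elim: es st => //= f es IHes st; rewrite inE => /predU1P [-> | e_in] lt0.
  exact: le_trans (foldl_relax_le _ _ _) (relax_edge lt0).
have le_f := relax_le st f e.1.
by apply: le_trans (IHes _ e_in _) _; [apply: le_lt_trans lt0 | rewrite lerD2r].
Qed.

Lemma foldl_relax_flag es (st : state) : st.2 -> (foldl relax st es).2.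
Proof.
elim: es st => //= e es IHes st st2; apply: IHes.
by rewrite /relax; case: ifP.
Qed.

(** A scan that leaves the flag unset changed nothing, so every edge was tested against [d]
    itself. *)
Lemma foldl_relax_noflag es (d : G -> int) e : ~~ (foldl relax (d, false) es).2 ->
  e \in es -> ~~ relaxable d e.
Proof.
elim: es => //= f es IHes; rewrite [relax _ f]/relax /=.
case: ifP => [_ /negP [] | rf nf]; first exact: foldl_relax_flag.
by rewrite inE => /predU1P [-> | /(IHes nf)]; rewrite ?rf.
Qed.

Lemma foldl_relax_change es (d : G -> int) : (foldl relax (d, false) es).2 ->
  exists v, (foldl relax (d, false) es).1 v < d v.
Proof.
elim: es => //= e es IHes; rewrite [relax _ e]/relax /=.
case: ifP => [/andP [_ re] _ | _]; last exact: IHes.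
exists e.2; apply: le_lt_trans (foldl_relax_le _ _ _) _.
by rewrite /= eqxx; lia.
Qed.

(** The length [L] is not tied to the number of rounds, since in-place updates can chain several
    edges within one round. *)
Definition realized (d : G -> int) : Prop :=
  forall v, d v = 0 \/ exists q L, [/\ walk q L, q L = v & scaled_cost q L = d v].

Lemma realized_le0 d v : realized d -> d v <= 0.
Proof.
case/(_ v) => [-> // | [q [L [[_ _ lt0] _ <-]]]].
exact/ltW/lt0.
Qed.

Lemma relax_realized (st : state) e : e \in edges G ->
  realized st.1 -> realized (relax st e).1.
Proof.
move=> e_in rd; rewrite /relax; case: ifP => //= /andP [lt1 lt2] v /=.
case: eqP => // ->; right.
case: (rd e.1) => [d0 | [q [L [qW qL cost]]]]; first lia.
(* The new value lies strictly below a nonpositive one, so it is negative, as the extended walk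
   requires. *)
have le2 := realized_le0 e.2 rd.
have [||q' [q'W q'L cost']] := walk_rcons qW (v := e.2).
- by rewrite qL -surjective_pairing.
- by rewrite cost qL -surjective_pairing; lia.
by exists q', L.+1; split=> //; rewrite cost' cost qL -surjective_pairing.
Qed.

Lemma foldl_relax_realized es (st : state) : {subset es <= edges G} ->
  realized st.1 -> realized (foldl relax st es).1.
Proof.
elim: es st => //= e es IHes st sub rd; apply: IHes.
  by move=> f f_in; apply: sub; rewrite inE f_in orbT.
by apply: relax_realized => //; apply: sub; rewrite mem_head.
Qed.

Lemma realized_dist0 : c <= 0 -> realized dist0.
Proof.
move=> c_le0 v; rewrite /dist0; case: eqP => [->|]; [right | by left].
exists (fun=> u), 0%N; rewrite scaled_cost0; split=> //; split=> // k.
by rewrite leqn0 => /eqP ->; rewrite scaled_cost0; nia.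
Qed.

(** * Correctness of the flag after [n] rounds *)

Section Rounds.
Variable es : seq (G * G).
Hypothesis mem_es : es =i edges G.

Lemma bellman_ford_realized k : c <= 0 -> realized (bellman_ford es k).1.
Proof.
move=> c_le0; elim: k => [|k IHk]; first exact: realized_dist0.
by rewrite /bellman_ford iterS; apply: foldl_relax_realized => // e; rewrite mem_es.
Qed.

Lemma bellman_ford_le k v : (bellman_ford es k.+1).1 v <= (bellman_ford es k).1 v.
Proof. by rewrite /bellman_ford iterS; apply: foldl_relax_le. Qed.

Lemma bellman_ford_source k : (bellman_ford es k).1 u <= #|G|.+1%:Z * c - 1.
Proof.
elim: k => [|k IHk]; first by rewrite /= /dist0 eqxx.
exact: le_trans (bellman_ford_le _ _) IHk.
Qed.

(** By induction, one round relaxes the last edge of the walk; its source value is negative because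
    all costs along a walk are. *)
Lemma bellman_ford_walk k L q : walk q L -> (L <= k)%N ->
  (bellman_ford es k).1 (q L) <= scaled_cost q L.
Proof.
elim: k L => [|k IHk] L qW; have [q0 qE q_lt0] := qW.
  by rewrite leqn0 => /eqP ->; rewrite q0 scaled_cost0; apply: bellman_ford_source.
rewrite leq_eqVlt => /predU1P [eqL|]; last first.
  by rewrite ltnS => leL; apply: le_trans (bellman_ford_le _ _) (IHk _ qW leL).
have {IHk} IHk : (bellman_ford es k).1 (q k) <= scaled_cost q k.
  apply: IHk => //; split=> // i ltk; first by apply: qE; lia.
  by apply: q_lt0; lia.
have lt0 : scaled_cost q k < 0 by apply: q_lt0; lia.
rewrite eqL scaled_costS.
have := @foldl_relax_edge es ((bellman_ford es k).1, false) (q k, q k.+1).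
rewrite mem_es => /(_ (qE _ _)) /= rel.
apply: le_trans (rel _ _) _; first by lia.
  exact: le_lt_trans lt0.
by rewrite lerD2r.
Qed.

Lemma bellman_ford_credit : c <= 0 ->
  (bellman_ford es #|G|).2 -> sufficient_credit u c.
Proof.
move=> c_le0; have G_gt0 : (0 < #|G|)%N by apply/card_gt0P; exists u.
have realN := bellman_ford_realized #|G| c_le0.
move: (realN); rewrite -(prednK G_gt0) /bellman_ford iterS -/(bellman_ford _ _).
set d := (bellman_ford es _) => realS /foldl_relax_change [v lt_v].
(* The old value is at most 0, so the smaller new one is not the default 0 and must come from a
   walk. *)
have le0 := realized_le0 v (bellman_ford_realized #|G|.-1 c_le0).
case: (realS v) => [d0 | [q [L [qW qL cost]]]].
  by move: lt_v; rewrite -/(relax_round es d) d0 ltNge le0.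
have [//|[q' [L' [q'W ltL' q'L' cost']]]] := walk_shorten qW.
(* A walk with fewer than [n] edges was already accounted for after [n-1] rounds, contradicting the
   strict decrease at [v]. *)
have := bellman_ford_walk q'W (k := #|G|.-1).
rewrite -ltnS prednK // => /(_ ltL'); rewrite q'L' qL -/d => le_d.
by have := lt_le_trans lt_v (le_trans le_d cost'); rewrite cost ltxx.
Qed.

Lemma credit_bellman_ford :
  sufficient_credit u c -> (bellman_ford es #|G|).2.
Proof.
case=> p [[p0 pE] p_le0]; apply: contrapT => /negP.
have G_gt0 : (0 < #|G|)%N by apply/card_gt0P; exists u.
rewrite -(prednK G_gt0) /bellman_ford iterS -/(bellman_ford _ _) => nflag.
pose d := (bellman_ford es #|G|.-1).1.
(* Prefix weights of [p] satisfy the credit, so its costs are negative; hence [d (p k) < 0], and the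
   edge can fail to be relaxable only through the second condition. *)
have le_p k : d (p k) <= scaled_cost p k.
  elim: k => [|k IHk].
    by rewrite p0 scaled_cost0; apply: bellman_ford_source.
  have := foldl_relax_noflag nflag (e := (p k, p k.+1)).
  rewrite mem_es => /(_ (pE k)); rewrite /relaxable /= scaled_costS.
  have : scaled_cost p k < 0 by have := p_le0 k; rewrite /scaled_cost; nia.
  by rewrite -/d; lia.
(* At index [M] the cost is at most [- 1 - M], below every value of [d]. *)
pose M := (\max_v `|d v|)%N.
have := le_p M; have : (`|d (p M)| <= M)%N by apply: leq_bigmax.
by have := p_le0 M; rewrite /scaled_cost; nia.
Qed.

End Rounds.
End Credit.

(** * Lower bounds on the values, for the word size *)

Lemma foldl_relax_ge (G : wgraph) (es : seq (G * G)) (st : state G) (N M : int) v :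
    0 <= M -> {in es, forall e, - M <= scaled_wt e} ->
    (forall v, - N <= st.1 v) ->
  - (N + (size es)%:Z * M) <= (foldl (@relax G) st es).1 v.
Proof.
move=> M_ge0; elim: es st N => [|e es IHes] st N wM dN /=.
  by rewrite mul0r addr0.
have -> : N + (size es).+1%:Z * M = N + M + (size es)%:Z * M by lia.
apply: IHes => [f f_in | x]; first by apply: wM; rewrite inE f_in orbT.
have wMe := wM e (mem_head _ _); have dNx := dN x; have dNe := dN e.1.
by rewrite /relax; case: ifP => _ /=; [case: eqP => _ | ]; lia.
Qed.

(** One [M] pays for the initial value and one for each scanned edge. So values stay polynomially
    bounded even when negative cycles keep lowering them. *)
Lemma bellman_ford_ge (G : wgraph) (u : G) (c : int) (es : seq (G * G)) (M : int) k v :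
    {in es, forall e, - M <= scaled_wt e} -> 0 <= M -> - M <= #|G|.+1%:Z * c - 1 ->
  - ((1 + k * size es)%:Z * M) <= (bellman_ford u c es k).1 v.
Proof.
move=> wM M_ge0 cM; elim: k v => [|k IHk] v.
  by rewrite /= /dist0; case: eqP => _; lia.
rewrite /bellman_ford iterS -/(bellman_ford _ _ _ _).
have -> : (1 + k.+1 * size es)%:Z * M
          = (1 + k * size es)%:Z * M + (size es)%:Z * M by lia.
exact: foldl_relax_ge.
Qed.

(** * Evaluation and loop rules of the machine *)

Section Machine.
Variables (B : nat) (inp : seq int).

Lemma wordE x : (`|x| <= B)%N -> word B x = Some x.
Proof. by rewrite /word => ->. Qed.

Lemma eval_const mem x : (`|x| <= B)%N -> eval B inp mem (Const x) = Some x.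
Proof. exact: wordE. Qed.

Lemma eval_read mem e (k : nat) x : eval B inp mem e = Some k%:Z ->
    (k < size mem)%N -> nth 0 mem k = x -> (`|x| <= B)%N ->
  eval B inp mem (Read e) = Some x.
Proof. by move=> /= -> /= -> /= ->; apply: wordE. Qed.

Lemma eval_input mem e (k : nat) x : eval B inp mem e = Some k%:Z ->
    (k < size inp)%N -> nth 0 inp k = x -> (`|x| <= B)%N ->
  eval B inp mem (Input e) = Some x.
Proof. by move=> /= -> /= -> /= ->; apply: wordE. Qed.

Lemma eval_bin mem o e1 e2 x y z : eval B inp mem e1 = Some x ->
    eval B inp mem e2 = Some y -> binop_val o x y = z -> (`|z| <= B)%N ->
  eval B inp mem (Bin o e1 e2) = Some z.
Proof. by move=> /= -> /= -> /= ->; apply: wordE. Qed.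

Lemma exec_store mem e1 e2 (k : nat) x mem' : eval B inp mem e1 = Some k%:Z ->
    (k < size mem)%N -> eval B inp mem e2 = Some x -> set_nth 0 mem k x = mem' ->
  exec B inp (Store e1 e2) mem (esize e1 + esize e2).+1 mem'.
Proof. by move=> ? ? ? <-; apply: ExecStore. Qed.

(** [M i] is the memory after [i] iterations; the last summand of the time pays for the final
    failing test. *)
Lemma exec_for (e : expr) (c : cmd) (M : nat -> seq int) (N T : nat) :
    (forall i, (i <= N)%N -> eval B inp (M i) e = Some (of_bool (i < N)%N)) ->
    (forall i, (i < N)%N -> exists2 t, exec B inp c (M i) t (M i.+1) & (t <= T)%N) ->
  exists2 t, exec B inp (While e c) (M 0%N) t (M N)
           & (t <= N * (T + esize e).+1 + (esize e).+1)%N.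
Proof.
elim: N M => [|N IHN] M testM bodyM.
  exists (esize e).+1 => //; apply: ExecWhileEnd.
  by rewrite testM.
have [//|t1 ex1 le1] := bodyM 0%N.
have [|//|t2 ex2 le2] := IHN (M \o succn).
- by move=> i le_i; apply: testM.
- by move=> i lt_i; apply: bodyM.
exists (esize e + t1 + t2).+1; last by lia.
by apply: ExecWhileStep ex1 ex2; first exact: testM.
Qed.

End Machine.

(** * The program *)

(* Cell 0 holds the flag, cell 1 the number of completed rounds, cell 2 the number
   of edges scanned in the current round; the distances start at cell 3. *)
Definition flag_addr := Const 0.
Definition round_addr := Const 1.
Definition scan_addr := Const 2%:Z.
Definition num_nodes := Input (Const 0).
Definition num_edges := Input (Const 1).
Definition dist_addr (e : expr) := Bin OpAdd (Const 3%:Z) e.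

(** The input has four header words, so [r] is 4, 5 or 6 for the source, target or weight of the
    scanned edge. *)
Definition edge_field (r : nat) :=
  Input (Bin OpAdd (Const r%:Z) (Bin OpMul (Const 3%:Z) (Read scan_addr))).
Definition source_dist := Read (dist_addr (edge_field 4)).
Definition target_dist := Read (dist_addr (edge_field 5)).
Definition scaled (e : expr) :=
  Bin OpSub (Bin OpMul (Bin OpAdd num_nodes (Const 1)) e) (Const 1).
Definition new_dist := Bin OpAdd source_dist (scaled (edge_field 6)).
Definition relax_test :=
  Bin OpAnd (Bin OpLeq source_dist (Const (-1)))
            (Bin OpLeq (Bin OpAdd new_dist (Const 1)) target_dist).

Definition incr (a : expr) := Store a (Bin OpAdd (Read a) (Const 1)).
Definition below (a e : expr) := Bin OpLeq (Bin OpAdd (Read a) (Const 1)) e.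

Definition relax_cmd :=
  Seq (If relax_test
         (Seq (Store (dist_addr (edge_field 5)) new_dist) (Store flag_addr (Const 1)))
         Skip)
      (incr scan_addr).

Definition round_cmd :=
  Seq (Store flag_addr (Const 0))
  (Seq (Store scan_addr (Const 0))
  (Seq (While (below scan_addr num_edges) relax_cmd)
       (incr round_addr))).

(** Zeroed memory already encodes unreached nodes and a zero round counter, so only the value of the
    source is initialised. The flag of the last round remains in cell 0 as the answer. *)
Definition credit_cmd :=
  Seq (Store (dist_addr (Input (Const 2%:Z))) (scaled (Input (Const 3%:Z))))
      (While (below round_addr num_nodes) round_cmd).

Lemma nth_flatten3 (T : Type) (f g h : T -> int) (x0 : T) s j r : (j < size s)%N ->
    (r < 3)%N ->
  nth 0 (flatten [seq [:: f x; g x; h x] | x <- s]) (3 * j + r)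
  = nth 0 [:: f (nth x0 s j); g (nth x0 s j); h (nth x0 s j)] r.
Proof.
elim: s j r => //= x s IHs [|j] r lt_j lt_r; first by case: r lt_r => [|[|[|r]]].
by rewrite mulnS -IHs.
Qed.

Lemma size_flatten3 (T : Type) (f g h : T -> int) s :
  size (flatten [seq [:: f x; g x; h x] | x <- s]) = (3 * size s)%N.
Proof. by elim: s => //= x s ->; rewrite mulnS. Qed.

Lemma set_nth_map (T : eqType) (d : T -> int) (s : seq T) v x : uniq s -> v \in s ->
  set_nth 0 (map d s) (index v s) x = map (fun w => if w == v then x else d w) s.
Proof.
elim: s => //= y s IHs /andP [ys us]; rewrite inE eq_sym.
case: eqVneq => [<- _ | ne /= vs] /=; rewrite ?eqxx ?(negbTE ne).
  by congr cons; apply/eq_in_map => w ws; case: eqP ys => // <-; rewrite ws.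
by rewrite IHs.
Qed.

(** * Simulation of the algorithm on the encoded graph *)

Section Program.
Variables (G : wgraph) (u : G) (c : int) (vs : seq G) (es : seq (G * G)).
Hypothesis vs_enum : perm_eq vs (enum G).
Hypothesis es_enum : perm_eq es (enum (edges G)).
Variable (B : nat).
Let inp := encode vs es u c.
Let n := #|G|.
Let m := #|edges G|.

Definition memory (st : state G) (i j : nat) : seq int :=
  [:: of_bool st.2, i%:Z, j%:Z & map st.1 vs].

Lemma size_vs : size vs = n.
Proof. by rewrite (perm_size vs_enum) -cardE. Qed.

Lemma size_es : size es = m.
Proof. by rewrite (perm_size es_enum) -cardE. Qed.

Lemma mem_vs v : v \in vs.
Proof. by rewrite (perm_mem vs_enum) mem_enum. Qed.

Lemma uniq_vs : uniq vs.
Proof. by rewrite (perm_uniq vs_enum) enum_uniq. Qed.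

Lemma mem_es : es =i edges G.
Proof. by move=> e; rewrite (perm_mem es_enum) mem_enum. Qed.

Lemma index_vs v : (index v vs < n)%N.
Proof. by rewrite -size_vs index_mem mem_vs. Qed.

Lemma size_memory st i j : size (memory st i j) = (3 + n)%N.
Proof. by rewrite /= size_map size_vs. Qed.

Lemma nth_memory (st : state G) i j v : nth 0 (memory st i j) (3 + index v vs) = st.1 v.
Proof. by rewrite /= (nth_map u) ?nth_index ?mem_vs // size_vs index_vs. Qed.

Lemma size_inp : size inp = (4 + 3 * m)%N.
Proof. by rewrite size_cat size_flatten3 size_es. Qed.

Lemma nth_inp e0 j r : (j < m)%N -> (r < 3)%N ->
  nth 0 inp (4 + r + 3 * j) =
  nth 0 [:: (index (nth e0 es j).1 vs)%:Z; (index (nth e0 es j).2 vs)%:Z;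
            wt (nth e0 es j)] r.
Proof.
rewrite -size_es => lt_j lt_r.
rewrite /inp /encode -addnA nth_cat /= [(r + _)%N]addnC addKn.
by rewrite (nth_flatten3 _ _ _ e0 lt_j lt_r).
Qed.

Hypothesis B_addr : (3 * m + n + 10 <= B)%N.

Lemma eval_small mem (k : nat) : (k <= 10)%N -> eval B inp mem (Const k%:Z) = Some k%:Z.
Proof. by move=> le_k; apply: eval_const; lia. Qed.

Lemma eval_num_nodes mem : eval B inp mem num_nodes = Some n%:Z.
Proof. by apply: (eval_input (k := 0)); rewrite ?eval_small //=; lia. Qed.

Lemma eval_num_edges mem : eval B inp mem num_edges = Some m%:Z.
Proof. by apply: (eval_input (k := 1)); rewrite ?eval_small //=; lia. Qed.

Lemma eval_edge_field st i j r e0 x : (j < m)%N -> (r < 3)%N ->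
    nth 0 [:: (index (nth e0 es j).1 vs)%:Z; (index (nth e0 es j).2 vs)%:Z;
              wt (nth e0 es j)] r = x -> (`|x| <= B)%N ->
  eval B inp (memory st i j) (edge_field (4 + r)) = Some x.
Proof.
move=> lt_j lt_r xE x_le; apply: (@eval_input _ _ _ _ (4 + r + 3 * j)) => //.
- apply: eval_bin; first by apply: eval_small; lia.
  + apply: (eval_bin (x := 3%:Z) (y := j%:Z)); [exact: eval_small | | reflexivity | ].
    * by apply: (@eval_read _ _ _ _ 2); rewrite ?eval_small //=; lia.
    * by rewrite /=; lia.
  + by rewrite /=; lia.
  + by lia.
- by rewrite size_inp; lia.
- by rewrite (nth_inp e0).
Qed.

Lemma eval_dist_addr mem e v : eval B inp mem e = Some (index v vs)%:Z ->
  eval B inp mem (dist_addr e) = Some (3 + index v vs)%:Z.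
Proof.
move=> eE; have := index_vs v => lt_v.
by apply: eval_bin eE _ _; [exact: eval_small | rewrite /=; lia | lia].
Qed.

Lemma eval_dist st i j e v : eval B inp (memory st i j) e = Some (index v vs)%:Z ->
  (`|st.1 v| <= B)%N -> eval B inp (memory st i j) (Read (dist_addr e)) = Some (st.1 v).
Proof.
move=> /eval_dist_addr eE st_le; apply: eval_read eE _ (nth_memory _ _ _ _) st_le.
by rewrite size_memory ltn_add2l index_vs.
Qed.

Lemma eval_scaled mem e (x : int) : eval B inp mem e = Some x ->
    (`|(n.+1%:Z * x)%R| < B)%N ->
  eval B inp mem (scaled e) = Some (n.+1%:Z * x - 1).
Proof.
move=> eE x_le; apply: eval_bin; [| exact: (eval_small _ (k := 1)) | reflexivity |].
  apply: (eval_bin (x := n.+1%:Z)) eE _ _; [| reflexivity | exact: ltnW].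
  apply: eval_bin (eval_num_nodes _) (eval_small _ (k := 1) _) _ _ => //=; lia.
by lia.
Qed.

Lemma eval_below mem a (k i N : nat) e : eval B inp mem a = Some k%:Z ->
    (k < size mem)%N -> nth 0 mem k = i%:Z -> (i < B)%N ->
    eval B inp mem e = Some N%:Z ->
  eval B inp mem (below a e) = Some (of_bool (i < N)%N).
Proof.
move=> aE k_lt kE i_lt eE; apply: (eval_bin (x := i.+1%:Z)) eE _ _ => //.
  apply: (eval_bin (x := i%:Z)); [| exact: (eval_small _ (k := 1)) | |].
  - by apply: eval_read aE _ kE _ => //; lia.
  - by rewrite /=; lia.
  - by lia.
by case: ltnP => _ /=; lia.
Qed.

Lemma exec_incr mem a (k i : nat) mem' : eval B inp mem a = Some k%:Z ->
    (k < size mem)%N -> nth 0 mem k = i%:Z -> (i < B)%N ->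
    set_nth 0 mem k i.+1%:Z = mem' ->
  exec B inp (incr a) mem (csize (incr a)) mem'.
Proof.
move=> aE k_lt kE i_lt <-; apply: (exec_store aE k_lt) => //.
apply: (eval_bin (x := i%:Z)); [| exact: (eval_small _ (k := 1)) | |].
- by apply: eval_read aE _ kE _ => //; lia.
- by rewrite /=; lia.
- by lia.
Qed.

Lemma of_boolB b : (`|of_bool b| <= B)%N.
Proof. by case: b => /=; lia. Qed.

(** The margin 2 in the word bound leaves room for the 1 subtracted in the scaled weight and the 1
    added in the test. *)
Lemma exec_relax_cmd (st : state G) i j (D : nat) e0 (e := nth e0 es j) : (j < m)%N ->
    (forall v, `|st.1 v| <= D)%N -> (`|wt e| <= B)%N ->
    (D + `|(n.+1%:Z * wt e)%R| + 2 <= B)%N ->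
  exists2 t, exec B inp relax_cmd (memory st i j) t (memory (relax st e) i j.+1)
           & (t <= csize relax_cmd)%N.
Proof.
move=> lt_j dD w_le wD; set mem := memory st i j.
have sE : eval B inp mem (edge_field 4) = Some (index e.1 vs)%:Z.
  by apply: (@eval_edge_field _ _ _ 0 e0) => //=; have := index_vs e.1; lia.
have tE : eval B inp mem (edge_field 5) = Some (index e.2 vs)%:Z.
  by apply: (@eval_edge_field _ _ _ 1 e0) => //=; have := index_vs e.2; lia.
have wE : eval B inp mem (edge_field 6) = Some (wt e).
  by apply: (@eval_edge_field _ _ _ 2 e0).
have d1 := dD e.1; have d2 := dD e.2.
have dsE : eval B inp mem source_dist = Some (st.1 e.1) by apply: eval_dist sE _; lia.
have dtE : eval B inp mem target_dist = Some (st.1 e.2) by apply: eval_dist tE _; lia.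
have newE : eval B inp mem new_dist = Some (st.1 e.1 + scaled_wt e).
  apply: (eval_bin dsE) => //; first by apply: eval_scaled wE _; lia.
  by rewrite /scaled_wt -/n; lia.
have testE : eval B inp mem relax_test = Some (of_bool (relaxable st.1 e)).
  apply: (eval_bin (x := of_bool (st.1 e.1 <= -1))
                   (y := of_bool (st.1 e.1 + scaled_wt e + 1 <= st.1 e.2))).
  - by apply: (eval_bin dsE) => //; [apply: eval_const => /=; lia | exact: of_boolB].
  - apply: eval_bin dtE _ _ => //; last exact: of_boolB.
    apply: (eval_bin newE (eval_small _ (k := 1) _)) => //.
    by rewrite /= /scaled_wt -/n; lia.
  - by rewrite /relaxable; do 2 case: (_ <= _).
  - exact: of_boolB.
have incrE st' : exec B inp (incr scan_addr) (memory st' i j) (csize (incr scan_addr))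
    (memory st' i j.+1).
  apply: (@exec_incr _ _ 2 j); rewrite ?eval_small //=; lia.
rewrite /relax; case: ifP testE => _ testE; eexists.
- apply: ExecSeq (incrE _); apply: (ExecIf testE); apply: ExecSeq.
    apply: (exec_store (eval_dist_addr tE) _ newE) => //.
    by rewrite size_memory ltn_add2l index_vs.
  apply: (@exec_store _ _ _ _ _ 0 1); rewrite ?eval_small //=.
  by rewrite /memory /= set_nth_map ?uniq_vs ?mem_vs.
- by [].
- apply: ExecSeq (incrE _); apply: (ExecIf testE); exact: ExecSkip.
- by [].
Qed.

(** A run is stuck as soon as one value overflows, so [D] must bound the values after every partial
    scan. *)
Lemma exec_round_cmd (st : state G) i j0 (D : nat) : (i < B)%N ->
    (forall j v, j <= m -> `|(foldl (@relax G) (st.1, false) (take j es)).1 v| <= D)%N ->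
    {in es, forall e, `|wt e| <= B}%N ->
    {in es, forall e, D + `|(n.+1%:Z * wt e)%R| + 2 <= B}%N ->
  exists2 t, exec B inp round_cmd (memory st i j0) t (memory (relax_round es st) i.+1 m)
           & (t <= m * (csize relax_cmd + esize (below scan_addr num_edges)).+1
                   + csize round_cmd)%N.
Proof.
move=> lt_iB dD wB wD.
pose M j := memory (foldl (@relax G) (st.1, false) (take j es)) i j.
have [||t ex_t le_t] := @exec_for B inp (below scan_addr num_edges) relax_cmd M m
  (csize relax_cmd).
- move=> j le_j; apply: (@eval_below _ _ 2); rewrite ?eval_small ?eval_num_edges //=.
  by lia.
- move=> j lt_j; have lt_js : (j < size es)%N by rewrite size_es.
  have e_in := mem_nth (u, u) lt_js.
  rewrite /M (take_nth (u, u)) // foldl_rcons.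
  apply: (exec_relax_cmd _ lt_j (D := D)); [| exact: wB | exact: wD].
  by move=> v; apply: dD; apply: ltnW.
rewrite /M take0 [take m es]take_oversize ?size_es // in ex_t.
eexists.
- apply: ExecSeq.
    by apply: (@exec_store _ _ _ _ _ 0 0 (memory (st.1, false) i j0)); rewrite ?eval_small.
  apply: ExecSeq.
    by apply: (@exec_store _ _ _ _ _ 2 0 (memory (st.1, false) i 0)); rewrite ?eval_small.
  apply: (ExecSeq ex_t).
  by apply: (@exec_incr _ _ 1 i); rewrite ?eval_small.
- by move: le_t; rewrite /=; lia.
Qed.

Lemma exec_credit_cmd (A : nat) : c <= 0 ->
    (A = 2 + n + m + max_weight G + `|c|)%N -> (A ^ 5 <= B)%N ->
  exists2 t, exec B inp credit_cmd (nseq (3 + n) 0) t (memory (bellman_ford u c es n) n m)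
           & (t <= n * (m * (csize relax_cmd + esize (below scan_addr num_edges)).+1
                   + csize round_cmd + esize (below round_addr num_nodes)).+1
                   + csize credit_cmd)%N.
Proof.
move=> c_le0 AE A_le.
have n_gt0 : (0 < n)%N by apply/card_gt0P; exists u.
have m_gt0 : (0 < m)%N.
  by apply/card_gt0P; have [v uv] := out_edge u; exists (u, v).
have wW e : e \in es -> (`|wt e| <= max_weight G)%N.
  rewrite mem_es => e_in.
  exact: (@leq_bigmax_cond _ (mem (edges G)) (fun e => `|wt e|%N)).
have nw_le e : e \in es -> (`|(n.+1%:Z * wt e)%R| + 1 <= A ^ 2)%N.
  by move/wW => we; rewrite abszM /=; nia.
have cM : - (A ^ 2)%:Z <= n.+1%:Z * c - 1 by nia.
have wM : {in es, forall e, - (A ^ 2)%:Z <= scaled_wt e}.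
  by move=> e /nw_le; rewrite /scaled_wt -/n; lia.
(* The initial value and each of the [n * m] relaxations contribute at most [A ^ 2]. Hence
   [D <= A ^ 4], and one more factor [A >= 4] absorbs the rest, which gives the exponent 5. *)
pose D := ((1 + n * m) * A ^ 2)%N.
have nm_le : (1 + n * m <= A ^ 2)%N by nia.
have D_le : (D + A ^ 2 + 2 <= B)%N.
  apply: leq_trans A_le; have : (D <= A ^ 2 * A ^ 2)%N by rewrite leq_mul2r nm_le orbT.
  have -> : (A ^ 5 = A * (A ^ 2 * A ^ 2))%N by rewrite -expnD -expnS.
  have : (16 <= A ^ 2)%N by nia.
  have : (4 <= A)%N by lia.
  move: (A ^ 2)%N => X; nia.
have A2_le : (A ^ 2 <= B)%N by lia.
have bf_D i j v : (i < n)%N -> (j <= m)%N ->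
    (`|(foldl (@relax G) ((bellman_ford u c es i).1, false) (take j es)).1 v| <= D)%N.
  move=> lt_i le_j.
  have sub_take e : e \in take j es -> - (A ^ 2)%:Z <= scaled_wt e.
    by move=> /mem_take /wM.
  have A2_ge0 : 0 <= (A ^ 2)%:Z by [].
  have ge := @foldl_relax_ge _ (take j es) ((bellman_ford u c es i).1, false) _ _ v
    A2_ge0 sub_take (fun v => @bellman_ford_ge _ u c es _ i v wM A2_ge0 cM).
  have le := foldl_relax_le (take j es) ((bellman_ford u c es i).1, false) v.
  have le0 := realized_le0 v (bellman_ford_realized u mem_es i c_le0).
  have := size_takel (_ : (j <= size es)%N); rewrite size_es => sz.
  rewrite sz // size_es -!PoszM -PoszD -mulnDl in ge.
  have : ((1 + i * m + j) * A ^ 2 <= D)%N.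
    by rewrite leq_mul2r -addnA leq_add2l; apply/orP; right; nia.
  by move: ge le le0 => /=; lia.
(* The scan counter is 0 only before the first round; every round ends with it at [m]. *)
have [||t ex_t le_t] := @exec_for B inp (below round_addr num_nodes) round_cmd
  (fun i => memory (bellman_ford u c es i) i (if i is 0 then 0 else m)) n
  (m * (csize relax_cmd + esize (below scan_addr num_edges)).+1 + csize round_cmd).
- move=> i le_i; apply: (@eval_below _ _ 1); rewrite ?eval_small ?eval_num_nodes //=.
  by lia.
- move=> i lt_i; apply: (exec_round_cmd _ (D := D)) => //; first by nia.
  + by move=> j v; apply: bf_D.
  + by move=> e /wW; nia.
  + by move=> e /nw_le; lia.
have nE : (if n is 0 then 0 else m) = m by case: (n) n_gt0.
rewrite nE /= in ex_t.
eexists; first apply: ExecSeq ex_t.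
- apply: exec_store.
  + apply: eval_dist_addr; apply: (@eval_input _ _ _ _ 2); rewrite ?eval_small //=.
    by have := index_vs u; lia.
  + by rewrite size_nseq ltn_add2l index_vs.
  + apply: eval_scaled; first apply: (@eval_input _ _ _ _ 3); rewrite ?eval_small //=.
      by nia.
    by rewrite abszM /=; nia.
  + have -> : nseq (3 + n) 0 = [:: 0, 0, 0 & map (fun=> 0) vs] :> seq int.
      by rewrite -size_vs /=; do 3!congr cons; elim: (vs) => //= v s ->.
    by rewrite /memory /= set_nth_map ?uniq_vs ?mem_vs.
- by move: le_t; rewrite /=; lia.
Qed.

End Program.

Theorem theorem5 :
  exists (p : cmd) (K : nat),
    forall (G : wgraph) (u : G) (c : int) (inp : seq int),
      c <= 0 -> is_input u c inp ->
      answers_within p inp (magnitude G c ^ K)%N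
        (K * (#|G| * #|edges G|))%N (K * #|G|)%N
        (c%:E <= min_credit u)%E.
Proof.
(* As [n] and [m] are at least 1, the sum of all program sizes bounds the coefficient of [n * m] in
   the time. The summand 5 covers the word exponent, the three extra cells and the additive
   constants. *)
pose K := (csize relax_cmd + esize (below scan_addr num_edges) + csize round_cmd
  + esize (below round_addr num_nodes) + csize credit_cmd + 5)%N.
have K_ge5 : (5 <= K)%N by rewrite leq_addl.
exists credit_cmd, K => G u c inp c_le0 [vs [es [vs_enum es_enum ->]]].
have n_gt0 : (0 < #|G|)%N by apply/card_gt0P; exists u.
have m_gt0 : (0 < #|edges G|)%N.
  by apply/card_gt0P; have [v uv] := out_edge u; exists (u, v).
have mag_gt0 : (0 < magnitude G c)%N by rewrite /magnitude; lia.
have B_ge : (magnitude G c ^ 5 <= magnitude G c ^ K)%N by rewrite leq_pexp2l.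
have B_addr : (3 * #|edges G| + #|G| + 10 <= magnitude G c ^ K)%N.
  apply: leq_trans B_ge; apply: (@leq_trans (magnitude G c ^ 2)).
    by rewrite /magnitude; nia.
  by rewrite leq_pexp2l // (leq_trans _ K_ge5).
have [t ex_t le_t] := exec_credit_cmd u vs_enum es_enum B_addr c_le0 erefl B_ge.
exists (3 + #|G|)%N, t; eexists; split; first exact: ex_t.
- apply: leq_trans le_t _; rewrite /K.
  move: (csize relax_cmd) (csize round_cmd) (csize credit_cmd) => a b d.
  by move: (esize _) (esize _) => x y; nia.
- by rewrite /K; nia.
- congr of_bool; apply/idP/idP.
    by move/(bellman_ford_credit (mem_es es_enum) c_le0)/le_min_credit.
  by move/le_min_credit/(credit_bellman_ford (mem_es es_enum)).
Qed.
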